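(* Let $X_1,\dots,X_m$ be a family of Hörmander vector fields on $\mathbb{R}^n$ and let $H=\sum_j X_j^*X_j$ be the associated Hörmander Laplacian. Let $V$ be a smooth function on $\mathbb{R}^n$ (possibly changing sign). If there is a positive smooth function $u$ on $\mathbb{R}^n$ satisfying $Hu-Vu\geq 0$ in $\mathbb{R}^n$, then for every bounded regular domain $D\subset\mathbb{R}^n$, $$\lambda^H_1(D):=\inf\Big\{\int_D(|Xf|^2-Vf^2)\,dx \;:\; f\in C^1_0(D),\ \int_D f^2\,dx=1\Big\}>0.$$
   Context: Smooth vector fields $X_1,\dots,X_m$ on $\mathbb{R}^n$ are Hörmander vector fields if they together with their commutators up to some fixed length span $\mathbb{R}^n$ at every point. Writing $X_j=A^{jk}(x)\partial_{x^k}$, the formal adjoint is $X_j^*f=-\partial_{x^k}(A^{jk}f)$, and the Hörmander Laplacian is $H=\sum_j X_j^*X_j=-\sum_{i,k}\partial_{x^i}(a^{ik}\partial_{x^k})$ with $a^{ik}=\sum_jA^{ji}A^{jk}$. For $f\in C^1$, $|Xf|^2=\sum_j|X_jf|^2$. A bounded domain is called regular if its boundary has no characteristic points for $H$. Standing assumption of the paper: nonnegative solutions of $Hu-Vu=0$ satisfy the local Harnack inequality (for each point $x_0$ there are $R,C>0$ with $\sup_{B_d(x_0,R)}u\le C\inf_{B_d(x_0,R)}u$, $B_d$ the ball of the control (Carnot–Carathéodory) metric of the $X_j$); this is known to hold for smooth $V$. *)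

(* Defs.v *)
From HB Require Import structures.
From mathcomp Require Import all_boot all_order all_algebra.
From mathcomp Require Import all_classical all_reals all_analysis.
Set Implicit Arguments. Unset Strict Implicit. Unset Printing Implicit Defensive.
Import Order.TTheory GRing.Theory Num.Theory.
Import numFieldNormedType.Exports.
Local Open Scope classical_set_scope.
Local Open Scope ring_scope.

Section Hormander.
Variable R : realType.

Notation pt n := 'rV[R]_n.

Definition partial n (i : 'I_n) (f : pt n -> R) : pt n -> R :=
  fun x => 'D_(delta_mx 0 i) f x.

Fixpoint Ck n (k : nat) (f : pt n -> R) : Prop :=
  match k with
  | 0 => continuous f
  | k'.+1 => (forall x, differentiable f x) /\ forall i, Ck k' (partial i f)
  end.

Definition smooth n (f : pt n -> R) := forall k, Ck k f.

Definition vfield n := pt n -> pt n.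

Definition smooth_vfield n (Y : vfield n) := forall k : 'I_n, smooth (fun x => Y x 0 k).

Definition lie_bracket n (Y Z : vfield n) : vfield n :=
  fun x => 'D_(Y x) Z x - 'D_(Z x) Y x.

(* commutators of length <= r.+1 of the fields X_1..X_m *)
Fixpoint commutators n m (X : 'I_m -> vfield n) (r : nat) : set (vfield n) :=
  match r with
  | 0 => [set Y | exists j, Y = X j]
  | r'.+1 => commutators X r' `|`
             [set Y | exists j, exists2 Z, commutators X r' Z & Y = lie_bracket (X j) Z]
  end.

Definition hormander n m (X : 'I_m -> vfield n) :=
  (forall j, smooth_vfield (X j)) /\
  exists r, forall x (v : pt n), exists k (Ys : 'I_k -> vfield n) (c : 'I_k -> R),
    (forall i, commutators X r (Ys i)) /\ v = \sum_(i < k) c i *: Ys i x.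

Definition Xop n m (X : 'I_m -> vfield n) (j : 'I_m) (f : pt n -> R) : pt n -> R :=
  fun x => \sum_(k < n) X j x 0 k * partial k f x.

Definition Xadj n m (X : 'I_m -> vfield n) (j : 'I_m) (f : pt n -> R) : pt n -> R :=
  fun x => - \sum_(k < n) partial k (fun y => X j y 0 k * f y) x.

Definition Hlap n m (X : 'I_m -> vfield n) (f : pt n -> R) : pt n -> R :=
  fun x => \sum_(j < m) Xadj X j (Xop X j f) x.

Definition Xnorm2 n m (X : 'I_m -> vfield n) (f : pt n -> R) : pt n -> R :=
  fun x => \sum_(j < m) (Xop X j f x) ^+ 2.

(* Integral over R^n, defined as the iterated Lebesgue integral over the
   coordinates (agrees with the Lebesgue integral on R^n for the continuous
   compactly supported / bounded compactly supported integrands used here). *)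
Fixpoint iint (n : nat) : (pt n -> R) -> R :=
  match n return (pt n -> R) -> R with
  | 0 => fun f => f 0
  | n'.+1 => fun f =>
      Rintegral (@lebesgue_measure R) setT
        (fun t : R => iint (fun y : pt n' => f (row_mx (t%:M : 'M[R]_1) y)))
  end.

Definition integral_on n (D : set (pt n)) (f : pt n -> R) : R :=
  iint (fun x => if x \in D then f x else 0).

Definition C10 n (D : set (pt n)) (f : pt n -> R) :=
  Ck 1 f /\ compact (closure [set x | f x != 0]) /\ closure [set x | f x != 0] `<=` D.

Definition bounded_domain n (D : set (pt n)) :=
  D !=set0 /\ open D /\ connected D /\ bounded_set D.

(* x0 is a non-characteristic boundary point: near x0 the boundary is given by
   a smooth defining function rho (D = {rho < 0} near x0, grad rho(x0) <> 0)
   and some X_j is transversal to the boundary, i.e. X_j rho (x0) <> 0. *)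
Definition noncharacteristic n m (X : 'I_m -> vfield n) (D : set (pt n)) (x0 : pt n) :=
  exists (U : set (pt n)) (rho : pt n -> R),
    [/\ open U, U x0, smooth rho &
        (forall x, U x -> (D x <-> rho x < 0))] /\
    (exists i, partial i rho x0 != 0) /\
    (exists j, Xop X j rho x0 != 0).

Definition regular_domain n m (X : 'I_m -> vfield n) (D : set (pt n)) :=
  bounded_domain D /\
  forall x0, closure D x0 -> ~ D x0 -> noncharacteristic X D x0.

Definition lambda1 n m (X : 'I_m -> vfield n) (V : pt n -> R) (D : set (pt n)) : \bar R :=
  ereal_inf [set (integral_on D (fun x => Xnorm2 X f x - V x * f x ^+ 2))%:E
            | f in [set f | C10 D f /\ integral_on D (fun x => f x ^+ 2) = 1]].

End Hormander.

(* Main.v *)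
(* Write [div(h.X)] for [sum_j div(h_j X_j) = - sum_j X_j^* h_j].  Completing the
   square in [|Xf + h f|^2 >= 0] and integrating by parts gives Barta's bound
   [int |Xf|^2 >= int (div(h.X) - |h|^2) f^2] for all smooth coefficients [h].
   With [h_j = - X_j u / u] the factor of [f^2] is [Hu/u >= V].  If moreover
   [div(k.X) = 1], then [h_j = - X_j u / u + eps k_j / u^2] turns it into
   [Hu/u + eps u^-2 - eps^2 |k|^2 u^-4], which exceeds [V] by a positive constant
   on the bounded set [D] once [eps] is small.
   Such [k] exists by Hörmander's condition.  The field [x_0 d/dx_0] has divergence
   one and is a smooth combination of commutators (through the inverse of their Gram
   matrix), and commutators reduce to the [X_j] under the divergence because
   [div(g [Y,Z]) = div(div(gZ) Y) - div(div(gY) Z)]. *)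
Require Import Defs.
From HB Require Import structures.
From mathcomp Require Import all_boot all_order all_algebra.
From mathcomp Require Import all_classical all_reals all_analysis.
From mathcomp Require Import ring lra.
Import Order.TTheory GRing.Theory Num.Theory.
Import numFieldNormedType.Exports.
Local Open Scope classical_set_scope.
Local Open Scope ring_scope.
Set Implicit Arguments. Unset Strict Implicit. Unset Printing Implicit Defensive.

(** * Calculus of partial derivatives and of $C^k$ functions *)

Section smooth_functions.
Context {R : realType} {n : nat}.
Implicit Types (f g : 'rV[R]_n -> R) (i : 'I_n) (x : 'rV[R]_n) (k : nat).

Lemma partial_cst (c : R) i x : partial i (fun=> c) x = 0.
Proof. by rewrite /partial (derive_cst c). Qed.

Lemma partialD f g i x : differentiable f x -> differentiable g x ->
  partial i (fun y => f y + g y) x = partial i f x + partial i g x.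
Proof. by move=> df dg; rewrite /partial (@deriveD _ _ _ f g)//; exact: diff_derivable. Qed.

Lemma partialN f i x : differentiable f x ->
  partial i (fun y => - f y) x = - partial i f x.
Proof. by move=> df; rewrite /partial (@deriveN _ _ _ f)//; exact: diff_derivable. Qed.

Lemma partialB f g i x : differentiable f x -> differentiable g x ->
  partial i (fun y => f y - g y) x = partial i f x - partial i g x.
Proof. by move=> df dg; rewrite /partial (@deriveB _ _ _ f g)//; exact: diff_derivable. Qed.

Lemma partialM f g i x : differentiable f x -> differentiable g x ->
  partial i (fun y => f y * g y) x = f x * partial i g x + g x * partial i f x.
Proof. by move=> df dg; rewrite /partial (@deriveM _ _ f g)//; exact: diff_derivable. Qed.

Lemma partialV f i x : differentiable f x -> f x != 0 ->
  partial i (fun y => (f y)^-1) x = - (f x)^-1 ^+ 2 * partial i f x.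
Proof.
move=> df f0; rewrite /partial (@deriveV _ _ f)//; last exact: diff_derivable.
by rewrite exprVn.
Qed.

Lemma differentiable_bigsum (I : Type) (r : seq I) (P : pred I)
    (F : I -> 'rV[R]_n -> R) x :
  (forall j, differentiable (F j) x) ->
  differentiable (fun y => \sum_(j <- r | P j) F j y) x.
Proof.
move=> dF; elim: r => [|a r ih].
  under eq_fun do rewrite big_nil; exact: differentiable_cst.
under eq_fun do rewrite big_cons.
by case: (P a) => //; apply: (@differentiableD _ _ _ (F a)).
Qed.

Lemma partial_sum (I : Type) (r : seq I) (P : pred I)
    (F : I -> 'rV[R]_n -> R) i x :
  (forall j, differentiable (F j) x) ->
  partial i (fun y => \sum_(j <- r | P j) F j y) x =
  \sum_(j <- r | P j) partial i (F j) x.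
Proof.
move=> dF; elim: r => [|a r ih].
  by under eq_fun do rewrite big_nil; rewrite big_nil partial_cst.
under eq_fun do rewrite big_cons; rewrite big_cons.
case: (P a) => //; rewrite partialD ?ih//; exact: differentiable_bigsum.
Qed.

Lemma CkS k f :
  Ck k.+1 f <-> (forall x, differentiable f x) /\ forall i, Ck k (partial i f).
Proof. by []. Qed.

Lemma Ck_pred k f : Ck k.+1 f -> Ck k f.
Proof.
elim: k f => [|k ih] f /CkS[df Df]; first by move=> x; exact: differentiable_continuous.
by apply/CkS; split=> // i; exact: ih.
Qed.

Lemma Ck_cst k (c : R) : Ck k (fun _ : 'rV[R]_n => c).
Proof.
elim: k c => [|k ih] c; first by move=> x; exact: cst_continuous.
apply/CkS; split=> [x|i]; first exact: differentiable_cst.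
by rewrite (funext (partial_cst c i)); exact: ih.
Qed.

Lemma CkD k f g : Ck k f -> Ck k g -> Ck k (fun x => f x + g x).
Proof.
elim: k f g => [|k ih] f g; first by move=> cf cg x; exact: (continuousD (cf x) (cg x)).
move=> /CkS[df Df] /CkS[dg Dg]; apply/CkS; split=> [x|i]; first exact: (differentiableD (df x) (dg x)).
by rewrite (funext (fun x => partialD i (df x) (dg x))); exact: ih.
Qed.

Lemma CkM k f g : Ck k f -> Ck k g -> Ck k (fun x => f x * g x).
Proof.
elim: k f g => [|k ih] f g; first by move=> cf cg x; exact: (continuousM (cf x) (cg x)).
move=> Cf Cg; have /CkS[df Df] := Cf; have /CkS[dg Dg] := Cg.
apply/CkS; split=> [x|i]; first exact: (differentiableM (df x) (dg x)).
rewrite (funext (fun x => partialM i (df x) (dg x))).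
by apply: CkD; apply: ih => //; exact: Ck_pred.
Qed.

Lemma CkN k f : Ck k f -> Ck k (fun x => - f x).
Proof. by under eq_fun do rewrite -mulN1r; apply: CkM; exact: Ck_cst. Qed.

Lemma CkX k f p : Ck k f -> Ck k (fun x => f x ^+ p).
Proof.
move=> Cf; elim: p => [|p ih]; first exact: Ck_cst.
by under eq_fun do rewrite exprS; exact: CkM.
Qed.

Lemma CkV k f : (forall x, f x != 0) -> Ck k f -> Ck k (fun x => (f x)^-1).
Proof.
move=> f0; elim: k => [|k ih].
  by move=> cf x; apply: (@continuousV _ _ f) => //; exact: cf.
move=> Cf; have /CkS[df Df] := Cf.
apply/CkS; split=> [x|i]; first exact: (@differentiableV _ _ f).
rewrite (funext (fun x => partialV i (df x) (f0 x))).
apply: CkM => //; apply: CkN; apply: CkX; apply: ih; exact: Ck_pred.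
Qed.

Lemma Ck_sum k (I : Type) (r : seq I) (P : pred I) (F : I -> 'rV[R]_n -> R) :
  (forall j, Ck k (F j)) -> Ck k (fun x => \sum_(j <- r | P j) F j x).
Proof.
move=> CF; elim: r => [|a r ih].
  by under eq_fun do rewrite big_nil; exact: Ck_cst.
by under eq_fun do rewrite big_cons; case: (P a) => //; exact: CkD.
Qed.

Lemma Ck_prod k (I : Type) (r : seq I) (P : pred I) (F : I -> 'rV[R]_n -> R) :
  (forall j, Ck k (F j)) -> Ck k (fun x => \prod_(j <- r | P j) F j x).
Proof.
move=> CF; elim: r => [|a r ih].
  by under eq_fun do rewrite big_nil; exact: Ck_cst.
by under eq_fun do rewrite big_cons; case: (P a) => //; exact: CkM.
Qed.

Lemma partial_coord i j x : partial i (fun y => y 0 j) x = (i == j)%:R.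
Proof.
have H := @derive_mx _ _ 1 n id x (delta_mx 0 i) (@derivable_id _ _ _ _).
move: H; rewrite derive_id => /matrixP/(_ 0 j).
by rewrite !mxE eqxx /= eq_sym => ->.
Qed.

Lemma Ck_coord k j : Ck k (fun x : 'rV[R]_n => x 0 j).
Proof.
case: k => [|k]; first by move=> x; exact: coord_continuous.
apply/CkS; split=> [x|i]; first exact: differentiable_coord.
by rewrite (funext (partial_coord i j)); exact: Ck_cst.
Qed.

Lemma smooth_differentiable f x : smooth f -> differentiable f x.
Proof. by move=> /(_ 1)[]. Qed.

Lemma smooth_partial f i : smooth f -> smooth (partial i f).
Proof. by move=> sf k; have [_] := sf k.+1; apply. Qed.

Lemma smooth_cst (c : R) : smooth (fun _ : 'rV[R]_n => c).
Proof. by move=> k; exact: Ck_cst. Qed.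

Lemma smoothD f g : smooth f -> smooth g -> smooth (fun x => f x + g x).
Proof. by move=> sf sg k; exact: CkD. Qed.

Lemma smoothM f g : smooth f -> smooth g -> smooth (fun x => f x * g x).
Proof. by move=> sf sg k; exact: CkM. Qed.

Lemma smoothN f : smooth f -> smooth (fun x => - f x).
Proof. by move=> sf k; exact: CkN. Qed.

Lemma smoothB f g : smooth f -> smooth g -> smooth (fun x => f x - g x).
Proof. by move=> sf sg; apply: smoothD => //; exact: smoothN. Qed.

Lemma smoothV f : (forall x, f x != 0) -> smooth f -> smooth (fun x => (f x)^-1).
Proof. by move=> f0 sf k; exact: CkV. Qed.

Lemma smooth_sum (I : Type) (r : seq I) (P : pred I) (F : I -> 'rV[R]_n -> R) :
  (forall j, smooth (F j)) -> smooth (fun x => \sum_(j <- r | P j) F j x).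
Proof. by move=> sF k; apply: Ck_sum => j; exact: sF. Qed.

Lemma smooth_prod (I : Type) (r : seq I) (P : pred I) (F : I -> 'rV[R]_n -> R) :
  (forall j, smooth (F j)) -> smooth (fun x => \prod_(j <- r | P j) F j x).
Proof. by move=> sF k; apply: Ck_prod => j; exact: sF. Qed.

Lemma derive_partial f x (v : 'rV[R]_n) : differentiable f x ->
  'D_v f x = \sum_i v 0 i * partial i f x.
Proof.
move=> df; rewrite deriveE// [in LHS](row_sum_delta v) linear_sum /=.
by apply: eq_bigr => i _; rewrite linearZ /= /partial deriveE.
Qed.

End smooth_functions.

(** * Symmetry of second partial derivatives *)

Section mixed_partials.
Context {R : realType} {n : nat}.
Implicit Types (f g : 'rV[R]_n -> R) (i j : 'I_n) (x y : 'rV[R]_n).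

(** Turns a partial derivative into the derivative of a function of one real variable, to which the
    mean value theorem applies. *)
Lemma is_derive_line f i y (s : R) : differentiable f (y + s *: delta_mx 0 i) ->
  is_derive s 1 (fun t => f (y + t *: delta_mx 0 i))
    (partial i f (y + s *: delta_mx 0 i)).
Proof.
move=> df; have Df := diff_derivable (v := delta_mx 0 i) df.
have E : (fun h : R => h^-1 *: (f (y + (h *: 1 + s) *: delta_mx 0 i) -
             f (y + s *: delta_mx 0 i))) =
         (fun h : R => h^-1 *: (f (h *: delta_mx 0 i + (y + s *: delta_mx 0 i)) -
             f (y + s *: delta_mx 0 i))).
  by apply/funext => h; rewrite [h *: 1]mulr1 scalerDl addrCA.
apply: DeriveDef; first by rewrite /derivable E.
by rewrite /partial /derive E.
Qed.

(** The mean value theorem is applied twice: in direction [i] to the increment [g] of [f] along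
    [h *: b], then in direction [j] to [partial i f]. *)
Lemma second_difference f i j x (h : R) : Ck 2 f -> 0 < h ->
  exists s t : R, [/\ 0 < s < h, 0 < t < h &
    f (x + h *: delta_mx 0 i + h *: delta_mx 0 j) - f (x + h *: delta_mx 0 i)
    - f (x + h *: delta_mx 0 j) + f x =
    partial j (partial i f) (x + s *: delta_mx 0 i + t *: delta_mx 0 j) * h * h].
Proof.
move=> /CkS[df /(_ i)/CkS[ddf _]] h0.
set a : 'rV[R]_n := delta_mx 0 i; set b : 'rV[R]_n := delta_mx 0 j.
pose g s := f (x + h *: b + s *: a) - f (x + s *: a).
pose dg s := partial i f (x + h *: b + s *: a) - partial i f (x + s *: a).
have gE (s : R) : is_derive s 1 g (dg s).
  by apply: is_deriveB; exact: is_derive_line.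
have [s] : exists2 c, c \in `]0, h[%R & g h - g 0 = dg c * (h - 0).
  apply: MVT => // z; apply: continuous_subspaceT => {}z.
  by apply: differentiable_continuous; apply/derivable1_diffP; exact: ex_derive.
rewrite in_itv /= subr0 => sh gh.
pose k t := partial i f (x + s *: a + t *: b).
pose dk t := partial j (partial i f) (x + s *: a + t *: b).
have kE (t : R) : is_derive t 1 k (dk t) by exact: is_derive_line.
have [t] : exists2 c, c \in `]0, h[%R & k h - k 0 = dk c * (h - 0).
  apply: MVT => // z; apply: continuous_subspaceT => {}z.
  by apply: differentiable_continuous; apply/derivable1_diffP; exact: ex_derive.
rewrite in_itv /= subr0 => th kh.
exists s, t; split=> //; rewrite -/(dk t) -kh.
have -> : k h - k 0 = dg s by rewrite /k /dg scale0r addr0 (addrAC x).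
rewrite -gh /g !scale0r !addr0 (addrAC x (h *: b)).
by move: (f _) (f _) (f _) (f _) => p q r w; ring.
Qed.

(** The second difference is symmetric in [i] and [j], so the two mixed partials take a common value
    at two points as close to [x] as desired. Continuity of both at [x] then forces equality
    there. *)
Lemma partialC f i j x : Ck 2 f ->
  partial i (partial j f) x = partial j (partial i f) x.
Proof.
move=> Cf; have /CkS[df Df] := Cf.
have /CkS[_ /(_ i) cij] := Df j; have /CkS[_ /(_ j) cji] := Df i.
apply/eqP; rewrite -subr_eq0 -normr_le0; apply/ler_addgt0Pl => e e0.
rewrite addr0.
have e2 : 0 < e / 2 by rewrite divr_gt0.
have := cij x; move/cvgrPdist_lt => /(_ _ e2) /nbhs_ballP[d1 /= d10 H1].
have := cji x; move/cvgrPdist_lt => /(_ _ e2) /nbhs_ballP[d2 /= d20 H2].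
set a : 'rV[R]_n := delta_mx 0 i; set b : 'rV[R]_n := delta_mx 0 j.
pose d := Order.min d1 d2.
have d0 : 0 < d by rewrite lt_min d10 d20.
(* This size keeps every displacement [s *: a + t *: b] with [s] and [t] in $(0,h)$ inside both
   continuity balls; the added 1 keeps the denominator positive. *)
pose h := d / (`|a| + `|b| + 1).
have ab0 : 0 < `|a| + `|b| + 1 by rewrite ltr_wpDl// addr_ge0.
have h0 : 0 < h by rewrite divr_gt0.
have close s t : 0 < s < h -> 0 < t < h -> `|s *: a + t *: b| < d.
  move=> /andP[s0 sh] /andP[t0 th].
  rewrite (le_lt_trans (ler_normD _ _))// !normrZ !gtr0_norm//.
  apply: (@le_lt_trans _ _ (h * (`|a| + `|b|))).
    by rewrite mulrDr lerD// ler_wpM2r// ltW.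
  by rewrite /h -mulrA gtr_pMr// mulrC ltr_pdivrMr// mul1r ltrDl.
have [s [t [sh th E1]]] := second_difference i j x Cf h0.
have [t' [s' [th' sh' E2]]] := second_difference j i x Cf h0.
have E : partial j (partial i f) (x + s *: a + t *: b) =
         partial i (partial j f) (x + t' *: b + s' *: a).
  have hI := mulIf (lt0r_neq0 h0); apply: (hI); apply: (hI).
  apply: etrans (esym E1) _; apply: etrans E2.
  rewrite -/a -/b [in RHS](addrAC x).
  by move: (f _) (f _) (f _) (f _) => p q r w; ring.
have inball (e' : R) (z : 'rV[R]_n) : `|z| < e' -> ball x e' (x + z).
  by move=> ze; rewrite -ball_normE /= opprD addrA subrr sub0r normrN.
have {}H1 : `|partial i (partial j f) x - partial i (partial j f) (x + t' *: b + s' *: a)| < e / 2.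
  apply: H1; rewrite -addrA; apply: inball.
  rewrite [X in `|X|]addrC; apply: lt_le_trans (close _ _ sh' th') _.
  by rewrite ge_min lexx.
have {}H2 : `|partial j (partial i f) x - partial j (partial i f) (x + s *: a + t *: b)| < e / 2.
  apply: H2; rewrite -addrA; apply: inball.
  by apply: lt_le_trans (close _ _ sh th) _; rewrite ge_min lexx orbT.
rewrite E in H2; apply: le_trans (ler_distD (partial i (partial j f) (x + t' *: b + s' *: a)) _ _) _.
rewrite [leRHS]splitr; apply: lerD; apply: ltW; first exact: H1.
rewrite distrC; exact: H2.
Qed.

End mixed_partials.

(** * Divergence of vector fields and of Lie brackets *)

Section divergence.
Context {R : realType} {n : nat}.
Implicit Types (f g : 'rV[R]_n -> R) (Y Z : vfield R n).

Definition divergence (Y : vfield R n) (x : 'rV[R]_n) : R :=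
  \sum_k partial k (fun y => Y y 0 k) x.

Definition dirderiv (Y : vfield R n) f (x : 'rV[R]_n) : R :=
  \sum_k Y x 0 k * partial k f x.

Lemma divergenceZ g Y x : differentiable g x ->
  (forall k, differentiable (fun y => Y y 0 k) x) ->
  divergence (fun y => g y *: Y y) x = g x * divergence Y x + dirderiv Y g x.
Proof.
move=> dg dY; rewrite /divergence /dirderiv mulr_sumr -big_split /=.
apply: eq_bigr => k _; under eq_fun do rewrite mxE.
by rewrite partialM.
Qed.

Lemma divergence_sum (I : Type) (r : seq I) (P : pred I) (F : I -> vfield R n) x :
  (forall i k, differentiable (fun y => F i y 0 k) x) ->
  divergence (fun y => \sum_(i <- r | P i) F i y) x =
  \sum_(i <- r | P i) divergence (F i) x.
Proof.
move=> dF; rewrite /divergence exchange_big /=; apply: eq_bigr => k _.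
by rewrite -partial_sum//; under eq_fun do rewrite summxE.
Qed.

Lemma smooth_divergence Y : smooth_vfield Y -> smooth (divergence Y).
Proof. by move=> sY; apply: smooth_sum => k; exact: smooth_partial. Qed.

Lemma smooth_dirderiv Y f : smooth_vfield Y -> smooth f -> smooth (dirderiv Y f).
Proof.
by move=> sY sf; apply: smooth_sum => k; apply: smoothM => //; exact: smooth_partial.
Qed.

Lemma smooth_vfieldZ g Y : smooth g -> smooth_vfield Y ->
  smooth_vfield (fun x => g x *: Y x).
Proof. by move=> sg sY k; under eq_fun do rewrite mxE; exact: smoothM. Qed.

Lemma lie_bracketE Y Z x k : smooth_vfield Y -> smooth_vfield Z ->
  lie_bracket Y Z x 0 k =
  dirderiv Y (fun y => Z y 0 k) x - dirderiv Z (fun y => Y y 0 k) x.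
Proof.
move=> sY sZ.
have D (W : vfield R n) (v : 'rV[R]_n) : smooth_vfield W ->
    ('D_v W x) 0 k = \sum_i v 0 i * partial i (fun y => W y 0 k) x.
  move=> sW; rewrite derive_mx; last first.
    apply/derivable_mxP => i l; rewrite ord1; apply: diff_derivable.
    exact/smooth_differentiable/sW.
  by rewrite mxE derive_partial//; exact/smooth_differentiable/sW.
by rewrite /lie_bracket !mxE !D.
Qed.

Lemma smooth_lie_bracket Y Z : smooth_vfield Y -> smooth_vfield Z ->
  smooth_vfield (lie_bracket Y Z).
Proof.
move=> sY sZ k; rewrite (funext (fun x => lie_bracketE x k sY sZ)).
by apply: smoothB; exact: smooth_dirderiv.
Qed.

(* The difference of the two sides is the divergence of the field
   [div (g (Z (x) Y - Y (x) Z))], i.e. the double divergence of an antisymmetric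
   tensor, which vanishes because partial derivatives commute. *)
Lemma divergence_lie_bracket g Y Z x :
  smooth g -> smooth_vfield Y -> smooth_vfield Z ->
  divergence (fun y => g y *: lie_bracket Y Z y) x =
  divergence (fun y => divergence (fun z => g z *: Z z) y *: Y y) x -
  divergence (fun y => divergence (fun z => g z *: Y z) y *: Z y) x.
Proof.
move=> sg sY sZ.
have dg y := smooth_differentiable y sg.
have dY k y := smooth_differentiable y (sY k).
have dZ k y := smooth_differentiable y (sZ k).
pose B k i y := g y * (Z y 0 k * Y y 0 i - Y y 0 k * Z y 0 i).
have sB k i : smooth (B k i).
  by apply: smoothM => //; apply: smoothB; apply: smoothM; [exact: sZ|exact: sY|exact: sY|exact: sZ].
(* Exchanging the two indices and commuting the partials turns the double divergence into its own
   opposite, since [B] is antisymmetric. *)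
have B0 : \sum_i \sum_k partial i (partial k (B k i)) x = 0.
  set S := LHS; suff : S = - S by lra.
  rewrite {1}/S exchange_big -sumrN; apply: eq_bigr => i _.
  rewrite -sumrN; apply: eq_bigr => k _; rewrite (partialC k i)//; last exact: sB.
  have -> : B i k = fun y => - B k i y by apply/funext => y; rewrite /B; ring.
  have -> : partial k (fun y => - B k i y) = fun y => - partial k (B k i) y.
    by apply/funext => y; rewrite partialN//; exact: smooth_differentiable.
  by rewrite partialN//; exact/smooth_differentiable/smooth_partial.
have sdZ := smooth_divergence (smooth_vfieldZ sg sZ).
have sdY := smooth_divergence (smooth_vfieldZ sg sY).
have sW := smooth_lie_bracket sY sZ.
(* The inner divergence of [B] produces $g\,Z(Y_i)-g\,Y(Z_i)$, which is the bracket term, besides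
   the two terms where the derivative falls on $gZ_k$ or $gY_k$. *)
have PE i y : \sum_k partial k (B k i) y =
    divergence (fun z => g z *: Z z) y * Y y 0 i -
    divergence (fun z => g z *: Y z) y * Z y 0 i - g y * lie_bracket Y Z y 0 i.
  rewrite lie_bracketE// /dirderiv /divergence mulrBr !mulr_sumr !mulr_suml -!sumrB.
  apply: eq_bigr => k _.
  have -> : B k i = fun y => g y * Z y 0 k * Y y 0 i - g y * Y y 0 k * Z y 0 i.
    by apply/funext => z; rewrite /B; ring.
  have -> : (fun y => (g y *: Z y) 0 k) = fun y => g y * Z y 0 k.
    by apply/funext => z; rewrite mxE.
  have -> : (fun y => (g y *: Y y) 0 k) = fun y => g y * Y y 0 k.
    by apply/funext => z; rewrite mxE.
  have dgZ : differentiable (fun y => g y * Z y 0 k) y by exact: differentiableM.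
  have dgY : differentiable (fun y => g y * Y y 0 k) y by exact: differentiableM.
  have d1 : differentiable (fun y => g y * Z y 0 k * Y y 0 i) y.
    exact: (differentiableM dgZ).
  have d2 : differentiable (fun y => g y * Y y 0 k * Z y 0 i) y.
    exact: (differentiableM dgY).
  rewrite (partialB _ d1 d2) (partialM _ dgZ)// (partialM _ dgY)//.
  ring.
apply/eqP; rewrite eq_sym -subr_eq0 -B0 /divergence -!sumrB; apply/eqP.
apply: eq_bigr => i _; rewrite -partial_sum; last first.
  by move=> k; exact/smooth_differentiable/smooth_partial.
rewrite (funext (PE i)).
have dP f h : smooth f -> smooth h -> differentiable (fun y => f y * h y) x.
  by move=> sf sh; exact/smooth_differentiable/smoothM.
pose p y := divergence (fun z => g z *: Z z) y * Y y 0 i.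
pose q y := divergence (fun z => g z *: Y z) y * Z y 0 i.
pose r y := g y * lie_bracket Y Z y 0 i.
rewrite -/p -/q -/r /=.
have sp : smooth p by exact: smoothM (sY i).
have sq : smooth q by exact: smoothM (sZ i).
have sr : smooth r by exact: smoothM (sW i).
have spq := smoothB sp sq.
rewrite (partialB _ (smooth_differentiable x spq) (smooth_differentiable x sr)).
rewrite (partialB _ (smooth_differentiable x sp) (smooth_differentiable x sq)).
have scaleE h (W : vfield R n) : (fun y => (h y *: W y) 0 i) = (fun y => h y * W y 0 i).
  by apply/funext => y; rewrite mxE.
rewrite !scaleE -/p -/q -/r.
by move: (partial i p x) (partial i q x) (partial i r x) => a b c; ring.
Qed.

End divergence.

(** * Smooth matrix-valued functions *)

Section smooth_matrices.
Context {R : realType} {n : nat}.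

Definition smooth_mx p q (M : 'rV[R]_n -> 'M[R]_(p, q)) :=
  forall i j, smooth (fun x => M x i j).

Lemma smooth_mulmx p q r (M : 'rV[R]_n -> 'M[R]_(p, q)) (N : 'rV[R]_n -> 'M[R]_(q, r)) :
  smooth_mx M -> smooth_mx N -> smooth_mx (fun x => M x *m N x).
Proof.
move=> sM sN i j; under eq_fun do rewrite mxE.
by apply: smooth_sum => k; apply: smoothM; [exact: sM|exact: sN].
Qed.

Lemma smooth_trmx p q (M : 'rV[R]_n -> 'M[R]_(p, q)) :
  smooth_mx M -> smooth_mx (fun x => (M x)^T).
Proof. by move=> sM i j; under eq_fun do rewrite mxE; exact: sM. Qed.

Lemma smooth_det p (M : 'rV[R]_n -> 'M[R]_p) :
  smooth_mx M -> smooth (fun x => \det (M x)).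
Proof.
move=> sM; rewrite /determinant; apply: smooth_sum => s.
by apply: smoothM; [exact: smooth_cst|apply: smooth_prod => i; exact: sM].
Qed.

(** By Cramer's rule each entry of the inverse is a cofactor, polynomial in the entries, divided by
    the nowhere vanishing determinant. *)
Lemma smooth_invmx p (M : 'rV[R]_n -> 'M[R]_p) : (forall x, M x \in unitmx) ->
  smooth_mx M -> smooth_mx (fun x => invmx (M x)).
Proof.
move=> uM sM i j.
have -> : (fun x => invmx (M x) i j) =
    (fun x => (\det (M x))^-1 * ((-1) ^+ (j + i) * \det (row' j (col' i (M x))))).
  by apply/funext => x; rewrite /invmx uM !mxE.
apply: smoothM; first apply: smoothV; last apply: smoothM.
- by move=> x; rewrite -unitfE -unitmxE.
- exact: smooth_det.
- exact: smooth_cst.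
- by apply: smooth_det => k l; under eq_fun do rewrite !mxE; exact: sM.
Qed.

End smooth_matrices.

(** * Horizontal divergence and Hörmander's condition *)

Section horizontal_divergence.
Context {R : realType} {n m : nat}.
Variable X : 'I_m -> vfield R n.
Hypothesis sX : forall j, smooth_vfield (X j).
Implicit Types (g : 'rV[R]_n -> R) (Z : vfield R n).

(** Up to sign, the formal adjoint of the horizontal gradient $f\mapsto(X_jf)_j$. *)
Definition hdiv (h : 'I_m -> 'rV[R]_n -> R) (x : 'rV[R]_n) : R :=
  \sum_j divergence (fun y => h j y *: X j y) x.

Lemma hdivE h x : (forall j, smooth (h j)) ->
  hdiv h x = \sum_j (h j x * divergence (X j) x + dirderiv (X j) (h j) x).
Proof.
move=> sh; apply: eq_bigr => j _; rewrite divergenceZ//.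
  exact: smooth_differentiable.
by move=> k; exact/smooth_differentiable/sX.
Qed.

Lemma hdivB h h' x : (forall j, smooth (h j)) -> (forall j, smooth (h' j)) ->
  hdiv (fun j y => h j y - h' j y) x = hdiv h x - hdiv h' x.
Proof.
move=> sh sh'; rewrite !hdivE//; last by move=> j; exact: smoothB.
rewrite -sumrB; apply: eq_bigr => j _; rewrite mulrBl /dirderiv.
have -> : \sum_k X j x 0 k * partial k (fun y => h j y - h' j y) x =
    \sum_k X j x 0 k * partial k (h j) x - \sum_k X j x 0 k * partial k (h' j) x.
  rewrite -sumrB; apply: eq_bigr => k _.
  by rewrite partialB ?mulrBr//; exact: smooth_differentiable.
ring.
Qed.

Lemma hdiv_sum (I : finType) (h : I -> 'I_m -> 'rV[R]_n -> R) x :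
  (forall i j, smooth (h i j)) ->
  hdiv (fun j y => \sum_i h i j y) x = \sum_i hdiv (h i) x.
Proof.
move=> sh; rewrite [RHS]exchange_big /=; apply: eq_bigr => j _.
rewrite -divergence_sum; last first.
  by move=> i k; exact/smooth_differentiable/(smooth_vfieldZ (sh i j) (sX j)).
by under eq_fun do rewrite scaler_suml.
Qed.

Lemma hdiv_single j g x :
  hdiv (fun i y => if i == j then g y else 0) x = divergence (fun y => g y *: X j y) x.
Proof.
rewrite /hdiv (bigD1 j)//= eqxx big1 ?addr0// => i /negbTE ->.
rewrite /divergence big1// => k _.
by under eq_fun do rewrite scale0r mxE; exact: partial_cst.
Qed.

Lemma commutators_smooth r Z : commutators X r Z -> smooth_vfield Z.
Proof.
elim: r Z => [|r ih] Z /=; first by move=> [j ->].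
move=> [/ih//|[j [Z' /ih sZ' ->]]]; exact: smooth_lie_bracket.
Qed.

(** Induction on the commutator length, with [g] arbitrary. For [lie_bracket (X j) Z'] the bracket
    identity leaves a divergence along [X j], already horizontal, and one along the shorter
    commutator [Z'] with the new coefficient $\mathrm{div}(gX_j)$. *)
Lemma divergence_commutator r Z g : commutators X r Z -> smooth g ->
  exists h, (forall j, smooth (h j)) /\
            forall x, divergence (fun y => g y *: Z y) x = hdiv h x.
Proof.
have single j f : smooth f -> forall i : 'I_m, smooth (fun y => if i == j then f y else 0).
  by move=> sf i; case: eqP => // _; exact: smooth_cst.
elim: r Z g => [|r ih] Z g /=.
  move=> [j ->] sg; exists (fun i y => if i == j then g y else 0); split.
    exact: single.
  by move=> x; rewrite hdiv_single.
move=> [cZ|[j [Z' cZ' ->]]] sg; first exact: ih.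
have sZ' := commutators_smooth cZ'.
have sgZ := smooth_divergence (smooth_vfieldZ sg sZ').
have sgX := smooth_divergence (smooth_vfieldZ sg (sX j)).
have [h [sh hE]] := ih _ _ cZ' sgX.
pose f := divergence (fun z => g z *: Z' z).
exists (fun i y => (if i == j then f y else 0) - h i y); split.
  by move=> i; apply: smoothB => //; exact: single.
move=> x; rewrite hdivB//; last exact: single.
by rewrite hdiv_single divergence_lie_bracket// hE.
Qed.

(** A single finite family serving all points is what allows a Gram matrix to be formed; the pairs
    in ['I_m * I] index the new brackets. *)
Lemma commutators_enum r : exists (I : finType) (Y : I -> vfield R n),
  (forall i, commutators X r (Y i)) /\ forall Z, commutators X r Z -> exists i, Z = Y i.
Proof.
elim: r => [|r [I [Y [cY YI]]]] /=.
  by exists 'I_m, X; split=> [i|Z [j ->]]; [exists i|exists j].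
exists (I + 'I_m * I)%type, (fun s => match s with
  | inl i => Y i | inr (j, i) => lie_bracket (X j) (Y i) end).
split=> [[i|[j i]]|Z [/YI[i ->]|[j [Z' /YI[i ->] ->]]]].
- by left; exact: cY.
- by right; exists j, (Y i).
- by exists (inl i).
- by exists (inr (j, i)).
Qed.

(** Hörmander's condition gives coefficients point by point, with no regularity in [x]. The formula
    $c_i=WG^{-1}Y_i^T$ with the Gram matrix $G=\sum_iY_i^TY_i$ gives smooth ones, because
    $WG^{-1}G=W$. *)
Lemma hormander_smooth_span : hormander X -> exists (r : nat) (I : finType)
    (Y : I -> vfield R n), (forall i, commutators X r (Y i)) /\
  forall W, smooth_vfield W -> exists c : I -> 'rV[R]_n -> R,
    (forall i, smooth (c i)) /\ forall x, W x = \sum_i c i x *: Y i x.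
Proof.
move=> [_ [r span]]; have [I [Y [cY YI]]] := commutators_enum r.
exists r, I, Y; split=> // W sW.
have sY i : smooth_mx (Y i).
  by move=> a b; rewrite ord1; exact: (commutators_smooth (cY i)).
pose G x := \sum_i (Y i x)^T *m Y i x.
have sG : smooth_mx G.
  move=> a b; under eq_fun do rewrite summxE.
  by apply: smooth_sum => i; apply: smooth_mulmx => //; exact: smooth_trmx.
have sqr0 p (v : 'rV[R]_p) : v *m v^T = 0 -> v = 0.
  move=> /matrixP/(_ 0 0); rewrite !mxE => v0; apply/rowP => j; rewrite mxE.
  have /psumr_eq0P H : \sum_j v 0 j * v^T j 0 = 0 by [].
  have /eqP : v 0 j * v^T j 0 = 0.
    by apply: H => // i _; rewrite mxE -expr2 sqr_ge0.
  by rewrite mxE mulf_eq0 orbb => /eqP.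
(* If $vG=0$ then $0=vGv^T=\sum_i(vY_i^T)^2$, so [v] is orthogonal to every [Y i x]. These span, so
   [v] is orthogonal to itself and vanishes. *)
have uG x : G x \in unitmx.
  rewrite -row_free_unit; apply: inj_row_free => v vG.
  have vY i : v *m (Y i x)^T = 0.
    have : \sum_i ((v *m (Y i x)^T) 0 0) ^+ 2 = 0.
      have : (v *m G x *m v^T) 0 0 = 0 by rewrite vG mul0mx mxE.
      rewrite /G mulmx_sumr mulmx_suml summxE => H; rewrite -[RHS]H.
      apply: eq_bigr => k _; rewrite mulmxA -mulmxA.
      rewrite [in RHS]mxE big_ord1 expr2; congr (_ * _).
      by rewrite -[Y k x in RHS]trmxK -trmx_mul [RHS]mxE.
    move/psumr_eq0P => H; apply/matrixP => a b; rewrite !ord1 [RHS]mxE.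
    by apply/eqP; rewrite -sqrf_eq0 H// => k _; exact: sqr_ge0.
  have [k [Z [c [cZ vE]]]] := span x v.
  apply: sqr0; rewrite {2}vE linear_sum /= mulmx_sumr big1// => i _.
  by have [j ->] := YI _ (cZ i); rewrite linearZ /= -scalemxAr vY scaler0.
exists (fun i x => (W x *m invmx (G x) *m (Y i x)^T) 0 0); split=> [i|x].
  apply: smooth_mulmx; last exact: smooth_trmx.
  apply: smooth_mulmx; last exact: smooth_invmx.
  by move=> a b; rewrite ord1; exact: sW.
transitivity (W x *m invmx (G x) *m G x); first by rewrite mulmxKV.
rewrite {2}/G mulmx_sumr; apply: eq_bigr => i _.
by rewrite mulmxA [X in X *m Y i x]mx11_scalar mul_scalar_mx.
Qed.

(** The field [W] is $x_0\,\partial_{x_0}$, of divergence one; [0 < n] provides this coordinate. Its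
    smooth expansion in commutators is made horizontal term by term, and the resulting coefficients
    are added up. *)
Lemma hormander_hdiv_eq1 : (0 < n)%N -> hormander X ->
  exists h, (forall j, smooth (h j)) /\ forall x, hdiv h x = 1.
Proof.
move=> n0 HX; pose i0 := Ordinal n0.
have [r [I [Y [cY span]]]] := hormander_smooth_span HX.
pose W (x : 'rV[R]_n) : 'rV[R]_n := x 0 i0 *: delta_mx 0 i0.
have scoord : smooth (fun x : 'rV[R]_n => x 0 i0) by move=> k; exact: Ck_coord.
have sW : smooth_vfield W.
  apply: smooth_vfieldZ => // k; exact: smooth_cst.
have divW x : divergence W x = 1.
  rewrite divergenceZ; last 2 first.
  - exact: smooth_differentiable.
  - by move=> k; exact: differentiable_cst.
  rewrite /divergence /dirderiv big1 ?mulr0 ?add0r; last first.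
    by move=> k _; exact: partial_cst.
  rewrite (bigD1 i0)//= big1 ?addr0; last first.
    by move=> k /negbTE ki; rewrite mxE ki andbF mul0r.
  by rewrite partial_coord mxE !eqxx mul1r.
have [c [sc WE]] := span W sW.
have /choice[h hP] i := divergence_commutator (cY i) (sc i).
have sh i j : smooth (h i j) := (hP i).1 j.
exists (fun j x => \sum_i h i j x); split=> [j|x]; first exact: smooth_sum.
rewrite hdiv_sum// -(divW x) (funext WE) divergence_sum; last first.
  move=> i k; apply/smooth_differentiable/smooth_vfieldZ => //.
  exact: commutators_smooth (cY i).
by apply: eq_bigr => i _; rewrite (hP i).2.
Qed.

End horizontal_divergence.

(** * Continuous functions of bounded support and their slices *)

Section supported_functions.
Context {R : realType}.

(** The norm on row vectors is the max norm, so the support lies in a cube, and fixing a coordinate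
    preserves the same [M]. *)
Definition supp_within n (M : R) (F : 'rV[R]_n -> R) :=
  continuous F /\ forall x, M < `|x| -> F x = 0.

Lemma normr_row_mx n (t : R) (y : 'rV[R]_n) :
  `|row_mx (t%:M : 'M[R]_1) y| = Num.max `|t| `|y|.
Proof.
have nE p (A : 'rV[R]_p) : `|A| = \big[Num.max/0]_ij `|A ij.1 ij.2| by exact: mx_normrE.
rewrite !nE; apply/le_anti/andP; split.
  apply: bigmax_le; first by rewrite le_max normr_ge0.
  move=> [i j] _ /=; rewrite ord1 le_max mxE; case: split_ordP => k _.
    by rewrite !ord1 mxE eqxx mulr1n lexx.
  by rewrite [X in _ || X](le_bigmax _ (fun ij => `|y ij.1 ij.2|) (0, k)) orbT.
rewrite ge_max; apply/andP; split.
  have := le_bigmax 0 (fun ij => `|row_mx (t%:M : 'M[R]_1) y ij.1 ij.2|) (0, lshift n 0).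
  by rewrite /= row_mxEl mxE eqxx mulr1n.
apply: bigmax_le; first by rewrite bigmax_ge_id.
move=> [i j] _ /=; rewrite ord1.
have := le_bigmax 0 (fun ij => `|row_mx (t%:M : 'M[R]_1) y ij.1 ij.2|) (0, rshift 1 j).
by rewrite /= row_mxEr.
Qed.

Lemma continuous_unifE n (F : 'rV[R]_n -> R) :
  (forall e, 0 < e -> exists2 d, 0 < d & forall x y, `|x - y| < d -> `|F x - F y| <= e) ->
  continuous F.
Proof.
move=> uF x; apply: (iffRL (@cvgrPdist_le _ _ _ (nbhs x) (nbhs_filter x) F (F x))) => e /uF[d d0 H].
by apply/nbhs_ballP; exists d => //= y; rewrite -ball_normE; exact: H.
Qed.

Lemma compact_normr_le n (r : R) : compact [set x : 'rV[R]_n | `|x| <= r].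
Proof.
apply: bounded_closed_compact.
  by exists r; split=> [|s rs x /= xr]; [exact: num_real|rewrite (le_trans xr)// ltW].
apply: (@closed_comp _ _ _ [set s : R | s <= r]) => [x _|].
  exact: norm_continuous.
exact: closed_le.
Qed.

(** Heine-Cantor on the compact ball of radius [M + 1]. Beyond it, points closer than 1 both lie
    where [F] vanishes. *)
Lemma supp_within_unif n (M : R) (F : 'rV[R]_n -> R) : supp_within M F ->
  forall e, 0 < e -> exists2 d, 0 < d & forall x y, `|x - y| < d -> `|F x - F y| <= e.
Proof.
move=> [cF F0] e e0.
(* Compactness in near-covering form, with the modulus [d] tending to $0^+$ as parameter: a modulus
   valid locally around each point becomes valid on the whole ball. *)
have /compact_near_coveringP/(_ R (0^'+)
  (fun d x => forall y, `|x - y| < d -> `|F x - F y| <= e) _) := @compact_normr_le n (M + 1).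
case.
  move=> x _.
  have e2 : 0 < e / 2 by rewrite divr_gt0.
  have := cF x; move/cvgrPdist_le => /(_ _ e2) /nbhs_ballP[d /= d0 H].
  have d2 : 0 < d / 2 by rewrite divr_gt0.
  exists (ball x (d / 2), [set t | t < d / 2]).
    split => /=; first exact: nbhsx_ballx.
    exact: nbhs_right_lt.
  move=> [x' t] /= [xx' td] y x'y.
  have Hx' : `|F x - F x'| <= e / 2.
    by apply: H; apply: le_ball xx'; rewrite ler_pdivrMr// ler_peMr ?ltW// ltr1n.
  have Hy : `|F x - F y| <= e / 2.
    apply: H; apply: (ball_split xx'); rewrite -ball_normE /=.
    exact: lt_trans td.
  rewrite (le_trans (ler_distD (F x) _ _))// distrC (splitr e).
  exact: lerD.
move=> d /= d0 H.
(* Halving gives a modulus strictly below [d]; the cap 1 matches the margin between [M] and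
   [M + 1]. *)
pose r := Num.min (d / 2) 1.
have r0 : 0 < r by rewrite lt_min divr_gt0 /=.
exists r => // x y xy.
have [xM|xM] := leP `|x| (M + 1).
  apply: (H r) => //=; rewrite sub0r normrN gtr0_norm//.
  by rewrite /r gt_min ltr_pdivrMr// ltr_pMr// ltr1n.
have yM : M < `|y|.
  have := ler_distD 0 x y; rewrite !subr0.
  have := lerB_dist x y.
  have r1 : r <= 1 by rewrite ge_min lexx orbT.
  lra.
by rewrite !F0 ?subrr ?normr0 ?ltW//; lra.
Qed.

Lemma supp_within0 n (M : R) : supp_within M (fun _ : 'rV[R]_n => 0).
Proof. by split=> // x; exact: cst_continuous. Qed.

Lemma supp_withinD n M (F G : 'rV[R]_n -> R) : supp_within M F -> supp_within M G ->
  supp_within M (fun x => F x + G x).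
Proof.
move=> [cF F0] [cG G0]; split=> [x|x Mx]; first exact: (continuousD (cF x) (cG x)).
by rewrite F0// G0// addr0.
Qed.

Lemma supp_withinMl n M (F G : 'rV[R]_n -> R) : continuous F -> supp_within M G ->
  supp_within M (fun x => F x * G x).
Proof.
move=> cF [cG G0]; split=> [x|x Mx]; first exact: (continuousM (cF x) (cG x)).
by rewrite G0// mulr0.
Qed.

(** Freezing the first coordinate mirrors the recursion that defines [iint]. *)
Definition slice n (t : R) (F : 'rV[R]_(1 + n) -> R) (y : 'rV[R]_n) : R :=
  F (row_mx (t%:M : 'M[R]_1) y).

Lemma slice_unif n (F : 'rV[R]_(1 + n) -> R) e d :
  (forall x y, `|x - y| < d -> `|F x - F y| <= e) ->
  forall s t x y, `|s - t| < d -> `|x - y| < d -> `|slice s F x - slice t F y| <= e.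
Proof.
move=> H s t x y st xy; apply: H.
by rewrite opp_row_mx add_row_mx -raddfB /= normr_row_mx gt_max st.
Qed.

Lemma supp_within_slice n M (F : 'rV[R]_(1 + n) -> R) t :
  supp_within M F -> supp_within M (slice t F).
Proof.
move=> sF; split; last first.
  by move=> y My; apply: sF.2; rewrite normr_row_mx lt_max My orbT.
apply: continuous_unifE => e /(supp_within_unif sF)[d d0 H]; exists d => // x y xy.
by apply: (slice_unif H) => //; rewrite subrr normr0.
Qed.

Lemma slice_eq0 n M (F : 'rV[R]_(1 + n) -> R) t : supp_within M F -> M < `|t| ->
  slice t F = fun=> 0.
Proof.
by move=> [_ F0] Mt; apply/funext => y; apply: F0; rewrite normr_row_mx lt_max Mt.
Qed.

End supported_functions.

(** * Integrals over the line of functions of bounded support *)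

Section integrals_on_line.
Context {R : realType}.
Notation mu := (@lebesgue_measure R).
Implicit Types (f g : R -> R) (M : R).

Lemma restrict_itv_eq f M : (forall t, M < `|t| -> f t = 0) -> f \_ `[- M, M] = f.
Proof.
move=> f0; apply/funext => t; rewrite patchE; case: ifPn => // /negP.
rewrite inE /= in_itv /= => tM; rewrite f0// ltNge ler_norml; exact/negP.
Qed.

Lemma supp_integrable f M : continuous f -> (forall t, M < `|t| -> f t = 0) ->
  mu.-integrable setT (EFin \o f).
Proof.
move=> cf f0.
have : mu.-integrable `[- M, M] (EFin \o f).
  apply: continuous_compact_integrable; first exact: segment_compact.
  exact: continuous_subspaceT.
move=> fi; have := (@integrable_mkcond _ _ _ mu `[- M, M] (EFin \o f) (measurable_itv _)).1 fi.
by rewrite restrict_EFin restrict_itv_eq.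
Qed.

Lemma supp_Rintegral f M : (forall t, M < `|t| -> f t = 0) ->
  Rintegral mu setT f = Rintegral mu `[- M, M] f.
Proof. by move=> f0; rewrite [RHS]Rintegral_mkcond restrict_itv_eq. Qed.

Lemma normr_supp_Rintegral f M e : 0 <= M -> continuous f ->
  (forall t, M < `|t| -> f t = 0) -> (forall t, `|f t| <= e) ->
  `|Rintegral mu setT f| <= e * (2 * M).
Proof.
move=> M0 cf f0 fe; rewrite (supp_Rintegral f0).
have cfi g : continuous g -> mu.-integrable `[- M, M] (EFin \o g).
  move=> cg; apply: continuous_compact_integrable; first exact: segment_compact.
  exact: continuous_subspaceT.
apply: le_trans (@le_normr_Rintegral _ _ _ mu `[- M, M] f (measurable_itv _) (cfi _ cf)) _.
have cn : continuous (fun t => `|f t|).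
  by move=> t; apply: continuous_comp; [exact: cf|exact: norm_continuous].
have ce : continuous (fun _ : R => e) by move=> t; exact: cst_continuous.
apply: le_trans (@le_Rintegral _ _ _ mu `[- M, M] _ _ (measurable_itv _) (cfi _ cn) (cfi _ ce) _) _ => //.
rewrite (@Rintegral_cst _ _ _ mu); last exact: measurable_itv.
have e0 : 0 <= e by exact: le_trans (fe 0).
have := @lebesgue_measure_itv R `[- M, M] => /= ->; rewrite ler_wpM2l// lte_fin.
(* The length of the interval is $2M$ if $-M<M$ and 0 in the degenerate case. *)
by case: ltP => _ /=; lra.
Qed.

Lemma Rintegral_supp_deriv f (df : R -> R) M : 0 <= M -> continuous df ->
  (forall t : R, is_derive t 1 f (df t)) -> (forall t, M < `|t| -> f t = 0) ->
  (forall t, M < `|t| -> df t = 0) -> Rintegral mu setT df = 0.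
Proof.
move=> M0 cdf fdf f0 df0.
(* [f] is known to vanish only strictly beyond [M]. On the larger interval it vanishes at both
   endpoints, and the fundamental theorem of calculus gives 0. *)
have M1 : M < M + 1 by rewrite ltrDl.
have {}df0 : forall t, M + 1 < `|t| -> df t = 0.
  by move=> t Mt; apply: df0; exact: lt_trans Mt.
rewrite (supp_Rintegral df0) /Rintegral.
have cf : continuous f.
  move=> t; apply: differentiable_continuous; apply/derivable1_diffP.
  exact: ex_derive.
rewrite (@continuous_FTC2 _ df f).
- by rewrite /= !f0 ?subr0 ?normrN// ger0_norm//; lra.
- lra.
- exact: continuous_subspaceT.
- split=> [t _||]; first exact: ex_derive.
    exact/cvg_at_right_filter/cf.
  exact/cvg_at_left_filter/cf.
- by move=> t _; rewrite derive1E; exact: derive_val.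
Qed.

End integrals_on_line.

(** * Linearity, bounds and integration by parts for the iterated integral *)

Section iterated_integral.
Context {R : realType}.
Notation mu := (@lebesgue_measure R).

(** Linearity and the bound are stated as properties of the dimension because they are proved by one
    joint induction. *)
Definition iint_linear n (M : R) := forall c (F G : 'rV[R]_n -> R),
  supp_within M F -> supp_within M G ->
  iint (fun x => c * F x + G x) = c * iint F + iint G.

Definition iint_bounded n (M : R) := forall (e : R) (F : 'rV[R]_n -> R),
  supp_within M F -> (forall x, `|F x| <= e) -> `|iint F| <= e * (2 * M) ^+ n.

Lemma iintS n (F : 'rV[R]_(1 + n) -> R) :
  iint F = Rintegral mu setT (fun t => iint (slice t F)).
Proof. by []. Qed.

Lemma iint_bounded0 n M : iint_bounded n M -> iint (fun _ : 'rV[R]_n => 0) = 0.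
Proof.
move=> B; apply/eqP; rewrite -normr_le0.
rewrite -[leRHS](mul0r ((2 * M) ^+ n)).
by apply: B => [|x]; [exact: supp_within0|rewrite normr0].
Qed.

Lemma iint_dist n (M e : R) (F G : 'rV[R]_n -> R) : iint_linear n M -> iint_bounded n M ->
  supp_within M F -> supp_within M G -> (forall x, `|F x - G x| <= e) ->
  `|iint F - iint G| <= e * (2 * M) ^+ n.
Proof.
move=> L B sF sG FG.
have -> : iint F - iint G = iint (fun x => -1 * G x + F x).
  by rewrite L// mulN1r addrC.
apply: B => [|x]; last by rewrite mulN1r addrC.
apply: supp_withinD => //; apply: supp_withinMl => // x; exact: cst_continuous.
Qed.

(** Uniform continuity of [F] makes nearby slices uniformly close, and integration over a cube of
    side $2M$ preserves closeness up to the factor $(2M)^n$. *)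
Lemma continuous_iint_slice n M (F : 'rV[R]_(1 + n) -> R) : 0 <= M ->
  iint_linear n M -> iint_bounded n M -> supp_within M F ->
  continuous (fun t => iint (slice t F)).
Proof.
move=> M0 L B sF t; apply/cvgrPdist_le => e e0.
(* The added 1 keeps the divisor of [e] positive even for [M = 0]. *)
have c0 : 0 < (2 * M) ^+ n + 1 by rewrite ltr_wpDl// exprn_ge0// mulr_ge0.
have [d d0 H] := supp_within_unif sF (divr_gt0 e0 c0).
exists d => //= s ts.
have sS r : supp_within M (slice r F) by exact: supp_within_slice.
apply: (le_trans (iint_dist (e := e / ((2 * M) ^+ n + 1)) L B (sS t) (sS s) _)).
  by move=> x; apply: (slice_unif H) => //; rewrite subrr normr0.
by rewrite mulrAC ler_pdivrMr// ler_wpM2l ?lerDl// ltW.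
Qed.

(** In the inductive step, linearity and the bound in dimension [n] together make [iint (slice t F)]
    continuous in [t], hence integrable, as linearity of the outer integral requires. *)
Lemma iint_supp n (M : R) : 0 <= M -> iint_linear n M /\ iint_bounded n M.
Proof.
move=> M0; elim: n => [|n [L B]].
  by split=> [c F G _ _ //|e F _ Fe]; rewrite expr0 mulr1; exact: Fe.
have sint (F : 'rV[R]_(1 + n) -> R) : supp_within M F ->
    mu.-integrable setT (EFin \o (fun t => iint (slice t F))).
  move=> sF; apply: (@supp_integrable _ _ M).
    exact: (continuous_iint_slice M0 L B sF).
  by move=> t Mt; rewrite (slice_eq0 sF Mt) (iint_bounded0 B).
split=> [c F G sF sG|e F sF Fe].
- rewrite !iintS.
  have -> : (fun t => iint (slice t (fun x : 'rV_(1 + n) => c * F x + G x))) =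
      (fun t => c * iint (slice t F) + iint (slice t G)).
    by apply/funext => t; rewrite -L//; exact: supp_within_slice.
  rewrite (@RintegralD _ _ _ mu)//=; last 2 first.
  + by have := @integrableZl _ _ _ mu setT measurableT c _ (sint _ sF); apply.
  + exact: sint.
  by rewrite (@RintegralZl _ _ _ mu)//; exact: sint.
- rewrite iintS exprSr mulrA; apply: normr_supp_Rintegral => //.
  + exact: (continuous_iint_slice M0 L B sF).
  + by move=> t Mt; rewrite (slice_eq0 sF Mt) (iint_bounded0 B).
  + by move=> t; apply: B => [|x]; [exact: supp_within_slice|exact: Fe].
Qed.

Lemma iint_ge0 n (F : 'rV[R]_n -> R) : (forall x, 0 <= F x) -> 0 <= iint F.
Proof.
elim: n F => [|n ih] F F0; first exact: F0.
by apply: (@Rintegral_ge0 _ _ _ mu) => t _; apply: ih => y; exact: F0.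
Qed.

(** Difference quotients have increments of either sign; the position of [c] is recorded only by its
    distance to [a]. *)
Lemma MVT_unordered (f df : R -> R) (a b : R) :
  (forall t : R, is_derive t 1 f (df t)) ->
  exists2 c, `|c - a| <= `|b - a| & f b - f a = df c * (b - a).
Proof.
move=> fdf.
have cf : continuous f.
  move=> t; apply: differentiable_continuous; apply/derivable1_diffP.
  exact: ex_derive.
have [ab|/ltW ba] := leP a b.
  have [c] := MVT_segment ab (fun t _ => fdf t) (continuous_subspaceT cf).
  rewrite in_itv /= => /andP[ac cb] E; exists c => //.
  by rewrite !ger0_norm ?subr_ge0// lerD2r.
have [c] := MVT_segment ba (fun t _ => fdf t) (continuous_subspaceT cf).
rewrite in_itv /= => /andP[ac cb] E; exists c.
  by rewrite !ler0_norm ?subr_le0// lerN2 lerD2r.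
by rewrite -opprB E; ring.
Qed.

Lemma supp_within_partial n M (F : 'rV[R]_n -> R) i : supp_within M F ->
  continuous (partial i F) -> supp_within M (partial i F).
Proof.
move=> [_ F0] cD; split=> // x Mx; rewrite -(partial_cst 0 i x).
apply: near_eq_derive.
have : nbhs x [set y | M < `|y|].
  apply: open_nbhs_nbhs; split=> //.
  apply: (@open_comp _ _ _ [set r : R | M < r]) => [y _|]; first exact: norm_continuous.
  exact: open_gt.
by apply: filterS => y /F0.
Qed.

Lemma delta_mx_lshift n : delta_mx 0 (lshift n 0) =
  row_mx (1%:M : 'M[R]_1) (0 : 'rV[R]_n).
Proof.
apply/rowP => j; rewrite [in RHS]mxE mxE eqxx /=; case: split_ordP => k ->.
  by rewrite !ord1 mxE !eqxx.
by rewrite mxE eq_rlshift.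
Qed.

Lemma delta_mx_rshift n (i : 'I_n) : delta_mx 0 (rshift 1 i) =
  row_mx (0 : 'M[R]_1) (delta_mx 0 i).
Proof.
apply/rowP => j; rewrite [in RHS]mxE mxE eqxx /=; case: split_ordP => k ->.
  by rewrite mxE eq_lrshift.
by rewrite mxE eqxx eq_rshift.
Qed.

Lemma is_derive_slice n (F : 'rV[R]_(1 + n) -> R) y (t : R) :
  derivable F (row_mx (t%:M : 'M[R]_1) y) (delta_mx 0 (lshift n 0)) ->
  is_derive t 1 (fun s => slice s F y) (slice t (partial (lshift n 0) F) y).
Proof.
move=> DF.
have E : (fun h : R => h^-1 *: (slice (h *: 1 + t) F y - slice t F y)) =
         (fun h : R => h^-1 *: (F (h *: delta_mx 0 (lshift n 0) + row_mx (t%:M : 'M[R]_1) y)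
            - F (row_mx (t%:M : 'M[R]_1) y))).
  apply/funext => h; rewrite delta_mx_lshift scale_row_mx add_row_mx scaler0 add0r.
  by rewrite scale_scalar_mx -raddfD.
apply: DeriveDef; first by rewrite /derivable E.
by rewrite /slice /partial /derive -E.
Qed.

(** Equality of the difference quotients themselves, so that both derivability and the value of the
    derivative pass to slices. *)
Lemma slice_growth n (F : 'rV[R]_(1 + n) -> R) y (t : R) (i : 'I_n) :
  (fun h : R => h^-1 *: (F (h *: delta_mx 0 (rshift 1 i) + row_mx (t%:M : 'M[R]_1) y)
            - F (row_mx (t%:M : 'M[R]_1) y))) =
  (fun h : R => h^-1 *: (slice t F (h *: delta_mx 0 i + y) - slice t F y)).
Proof.
apply/funext => h; rewrite delta_mx_rshift scale_row_mx add_row_mx scaler0 add0r.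
by [].
Qed.

(** Differentiation under the integral sign. By the mean value theorem the difference quotient at
    [y] is a value of [G] at a first coordinate within [|h|] of [t], and uniform continuity of [G]
    makes it close to [slice t G y] uniformly in [y]. *)
Lemma is_derive_iint_slice n M (F : 'rV[R]_(1 + n) -> R) (t : R) : 0 <= M ->
  supp_within M F -> continuous (partial (lshift n 0) F) ->
  (forall x, derivable F x (delta_mx 0 (lshift n 0))) ->
  is_derive t 1 (fun s => iint (slice s F)) (iint (slice t (partial (lshift n 0) F))).
Proof.
move=> M0 sF cD dF; set G := partial _ F.
have sG : supp_within M G by exact: supp_within_partial.
have [L B] := @iint_supp n M M0.
suff H : h^-1 *: (iint (slice (h *: 1 + t) F) - iint (slice t F)) @[h --> 0^'] -->
    iint (slice t G).
  apply: DeriveDef; first by apply/cvg_ex; exists (iint (slice t G)).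
  exact: cvg_lim H.
apply/cvgrPdist_le => e e0.
have c0 : 0 < (2 * M) ^+ n + 1 by rewrite ltr_wpDl// exprn_ge0// mulr_ge0.
have [d d0 H] := supp_within_unif sG (divr_gt0 e0 c0).
exists d => // h hd h0.
have {}hd : `|h| < d by rewrite -[h]opprK normrN -[- h]sub0r; exact: hd.
have sS (K : 'rV[R]_(1 + n) -> R) r : supp_within M K -> supp_within M (slice r K).
  exact: supp_within_slice.
have cc (c : R) : continuous (fun _ : 'rV[R]_n => c) by move=> x; exact: cst_continuous.
have -> : h^-1 *: (iint (slice (h *: 1 + t) F) - iint (slice t F)) =
    iint (fun y => h^-1 * slice (h *: 1 + t) F y + - h^-1 * slice t F y).
  rewrite L; [|exact: sS|apply: supp_withinMl => //; exact: sS].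
  (* A zero summand brings the scalar multiple into the form $cF+G$ of [iint_linear]. *)
  have -> : iint (fun y => - h^-1 * slice t F y) =
      iint (fun y => - h^-1 * slice t F y + 0).
    by congr iint; apply/funext => y; rewrite addr0.
  rewrite L; [|exact: sS|exact: supp_within0].
  by rewrite (iint_bounded0 B) addr0 mulNr -mulrBr.
have sD : supp_within M (fun y => h^-1 * slice (h *: 1 + t) F y + - h^-1 * slice t F y).
  by apply: supp_withinD; apply: supp_withinMl => //; exact: sS.
apply: (le_trans (iint_dist (e := e / ((2 * M) ^+ n + 1)) L B (sS _ t sG) sD _)); last first.
  by rewrite mulrAC ler_pdivrMr// ler_wpM2l ?lerDl// ltW.
move=> y.
(* The point [c] depends on [y], but its distance to [t] is at most [|h|] for every [y]. *)
have [c hc E] := MVT_unordered t (h *: 1 + t) (fun s => is_derive_slice (dF (row_mx (s%:M : 'M[R]_1) y))).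
have -> : h^-1 * slice (h *: 1 + t) F y + - h^-1 * slice t F y = slice c G y.
  rewrite mulNr -mulrBr E -/G; have -> : h *: 1 = h by exact: mulr1.
  by rewrite addrK mulrCA mulVf// mulr1.
apply: (slice_unif H); last by rewrite subrr normr0.
rewrite distrC (le_lt_trans hc)//.
by have -> : h *: 1 = h by [exact: mulr1]; rewrite addrK.
Qed.

(** For the first coordinate, the outer integrand is the derivative of a function of bounded
    support. For any other one, the partial derivative acts inside the slices, whose integrals
    vanish by induction. *)
Lemma iint_partial n M (F : 'rV[R]_n -> R) (i : 'I_n) : 0 <= M ->
  supp_within M F -> continuous (partial i F) ->
  (forall x, derivable F x (delta_mx 0 i)) -> iint (partial i F) = 0.
Proof.
move=> M0; elim: n F i => [F []//|n ih] F i.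
have [L B] := @iint_supp n M M0.
case: (@split_ordP 1 n i) => j ->.
- rewrite ord1 => sF cD dF.
  have sG := supp_within_partial sF cD.
  rewrite iintS; apply: (@Rintegral_supp_deriv _ (fun t => iint (slice t F)) _ M) => //.
  + exact: (continuous_iint_slice M0 L B sG).
  + by move=> t; exact: (is_derive_iint_slice t M0 sF cD dF).
  + by move=> t Mt; rewrite (slice_eq0 sF Mt) (iint_bounded0 B).
  + by move=> t Mt; rewrite (slice_eq0 sG Mt) (iint_bounded0 B).
- move=> sF cD dF; have sG := supp_within_partial sF cD.
  rewrite iintS; rewrite (_ : (fun t => _) = fun=> 0).
    by rewrite /Rintegral integral0.
  apply/funext => t.
  have E : slice t (partial (rshift 1 j) F) = partial j (slice t F).
    by apply/funext => y; rewrite /slice /partial /derive slice_growth.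
  rewrite E; apply: ih.
  + exact: supp_within_slice.
  + by rewrite -E; case: (supp_within_slice t sG).
  + by move=> y; rewrite /derivable -slice_growth; exact: dF.
Qed.

End iterated_integral.

(** * The perturbed ground state field and its Riccati expression *)

Section barta.
Context {R : realType} {n m : nat}.
Variable X : 'I_m -> vfield R n.
Hypothesis sX : forall j, smooth_vfield (X j).
Implicit Types f g : 'rV[R]_n -> R.

Lemma dirderivD (Y : vfield R n) f g x : differentiable f x -> differentiable g x ->
  dirderiv Y (fun y => f y + g y) x = dirderiv Y f x + dirderiv Y g x.
Proof.
move=> df dg; rewrite /dirderiv -big_split /=; apply: eq_bigr => k _.
by rewrite partialD// mulrDr.
Qed.

Lemma dirderivN (Y : vfield R n) f x : differentiable f x ->
  dirderiv Y (fun y => - f y) x = - dirderiv Y f x.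
Proof.
move=> df; rewrite /dirderiv -sumrN /=; apply: eq_bigr => k _.
by rewrite partialN// mulrN.
Qed.

Lemma dirderivM (Y : vfield R n) f g x : differentiable f x -> differentiable g x ->
  dirderiv Y (fun y => f y * g y) x = f x * dirderiv Y g x + g x * dirderiv Y f x.
Proof.
move=> df dg; rewrite /dirderiv !mulr_sumr -big_split /=; apply: eq_bigr => k _.
by rewrite partialM//; ring.
Qed.

Lemma dirderivV (Y : vfield R n) f x : differentiable f x -> f x != 0 ->
  dirderiv Y (fun y => (f y)^-1) x = - (f x)^-1 ^+ 2 * dirderiv Y f x.
Proof.
move=> df f0; rewrite /dirderiv mulr_sumr; apply: eq_bigr => k _.
by rewrite partialV//; ring.
Qed.

Lemma XadjE j f x : Xadj X j f x = - divergence (fun y => f y *: X j y) x.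
Proof.
rewrite /Xadj /divergence; congr (- _); apply: eq_bigr => k _; congr (partial k _ x).
by apply/funext => y; rewrite mxE mulrC.
Qed.

Variables (u : 'rV[R]_n -> R) (k : 'I_m -> 'rV[R]_n -> R) (eps : R).
Hypotheses (su : smooth u) (u0 : forall x, 0 < u x).
Hypotheses (sk : forall j, smooth (k j)).

(* [- X_j u / u] is the coefficient field of the ground state substitution
   [f = u phi]; the [k]-term makes its gain strict. *)
Definition barta_field j x := - (Xop X j u x / u x) + eps * (k j x * (u x)^-1 ^+ 2).

Let u_neq0 x : u x != 0. Proof. by rewrite gt_eqF. Qed.

Let sw : smooth (fun x => (u x)^-1). Proof. exact: smoothV. Qed.

Let sp j : smooth (Xop X j u). Proof. exact: smooth_dirderiv. Qed.

Let sw2 : smooth (fun x => (u x)^-1 ^+ 2).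
Proof. by move=> p; apply: CkX. Qed.

Let spw j : smooth (fun x => Xop X j u x / u x).
Proof. exact: smoothM. Qed.

Let skw j : smooth (fun x => k j x * (u x)^-1 ^+ 2).
Proof. exact: smoothM. Qed.

Lemma smooth_barta_field j : smooth (barta_field j).
Proof.
apply: smoothD; first exact: smoothN.
by apply: smoothM => //; exact: smooth_cst.
Qed.

(** The terms $(X_ju)^2/u^2$ cancel, as for the unperturbed field. The weight $u^{-2}$ on $k$ is
    chosen so that $\varepsilon k_jX_j(u^{-2})=-2\varepsilon k_jX_ju/u^3$ cancels the cross term of
    the square. *)
Lemma hdiv_barta_field x : hdiv X k x = 1 ->
  hdiv X barta_field x - \sum_j barta_field j x ^+ 2 =
  Hlap X u x / u x + eps * (u x)^-1 ^+ 2 -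
  eps ^+ 2 * (u x)^-1 ^+ 4 * \sum_j k j x ^+ 2.
Proof.
move=> hk.
(* Writing the factor 1 as [hdiv X k x] makes both sides sums over [j], to be compared term by
   term. *)
have -> : eps * (u x)^-1 ^+ 2 = eps * (u x)^-1 ^+ 2 * hdiv X k x by rewrite hk mulr1.
rewrite !hdivE//; last exact: smooth_barta_field.
rewrite /Hlap mulr_suml !mulr_sumr -sumrB -big_split -sumrB /=.
apply: eq_bigr => j _; rewrite XadjE divergenceZ; last 2 first.
- exact: smooth_differentiable.
- by move=> i; exact/smooth_differentiable/sX.
have d f : smooth f -> differentiable f x by exact: smooth_differentiable.
have dV := dirderivV (X j) (d _ su) (u_neq0 x).
have dV2 : dirderiv (X j) (fun y => (u y)^-1 ^+ 2) x =
    - 2 * (u x)^-1 ^+ 3 * dirderiv (X j) u x.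
  under eq_fun do rewrite expr2.
  by rewrite dirderivM ?dV; [ring|exact: d|exact: d].
have -> : dirderiv (X j) (barta_field j) x =
  - (Xop X j u x * dirderiv (X j) (fun y => (u y)^-1) x +
     (u x)^-1 * dirderiv (X j) (Xop X j u) x) +
  eps * (k j x * dirderiv (X j) (fun y => (u y)^-1 ^+ 2) x +
     (u x)^-1 ^+ 2 * dirderiv (X j) (k j) x).
  rewrite /barta_field dirderivD; [|exact/d/smoothN|]; last first.
    by apply/d/smoothM => //; exact: smooth_cst.
  rewrite dirderivN; last exact: d.
  rewrite dirderivM; [|exact: d|exact: d].
  rewrite dirderivM; [|exact: differentiable_cst|exact: d].
  rewrite dirderivM; [|exact: d|exact: d].
  have -> : dirderiv (X j) (fun=> eps) x = 0.
    by rewrite /dirderiv big1// => i _; rewrite partial_cst mulr0.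
  by rewrite mulr0 addr0.
rewrite dV dV2 /barta_field (_ : dirderiv (X j) u x = Xop X j u x)//.
set p := Xop X j u x; set a := dirderiv (X j) (Xop X j u) x.
set b := dirderiv (X j) (k j) x; set w := (u x)^-1.
by move: (divergence (X j) x) (k j x) p a b w => q c p a b w; ring.
Qed.

End barta.

(** * Integration by parts and Barta's inequality *)

Section integral_inequality.
Context {R : realType} {n m : nat}.
Variable X : 'I_m -> vfield R n.
Hypothesis sX : forall j, smooth_vfield (X j).
Implicit Types f g : 'rV[R]_n -> R.

Lemma iint_lincomb (M c : R) (F G : 'rV[R]_n -> R) : 0 <= M ->
  supp_within M F -> supp_within M G ->
  iint (fun x => c * F x + G x) = c * iint F + iint G.
Proof. by move=> M0; exact: (iint_supp n M0).1. Qed.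

Lemma iint_divergence (M : R) (Y : vfield R n) : 0 <= M ->
  (forall i, Ck 1 (fun x => Y x 0 i)) ->
  (forall i, supp_within M (fun x => Y x 0 i)) -> iint (divergence Y) = 0.
Proof.
move=> M0 CY sY.
have sD i : supp_within M (partial i (fun x => Y x 0 i)).
  by apply: supp_within_partial => //; case: (CY i) => _; apply.
rewrite /divergence; elim: (index_enum _) => [|i r ih].
  have -> : (fun x => \sum_(i <- [::]) partial i (fun y => Y y 0 i) x) = fun=> 0.
    by apply/funext => x; rewrite big_nil.
  exact: iint_bounded0 (iint_supp n M0).2.
have -> : (fun x => \sum_(j <- i :: r) partial j (fun y => Y y 0 j) x) =
    (fun x => 1 * partial i (fun y => Y y 0 i) x +
      \sum_(j <- r) partial j (fun y => Y y 0 j) x).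
  by apply/funext => x; rewrite big_cons mul1r.
rewrite (iint_lincomb _ M0)//; last first.
  elim: r {ih} => [|j r ihr].
    by under eq_fun do rewrite big_nil; exact: supp_within0.
  by under eq_fun do rewrite big_cons; exact: supp_withinD.
rewrite ih addr0 mul1r (iint_partial M0)//; first by case: (CY i) => _; apply.
by move=> x; apply: diff_derivable; case: (CY i).
Qed.

Lemma integral_on_supp (D : set 'rV[R]_n) (F : 'rV[R]_n -> R) :
  (forall x, ~ D x -> F x = 0) -> integral_on D F = iint F.
Proof.
move=> F0; rewrite /integral_on; congr iint; apply/funext => x.
by case: ifPn => // /negP xD; rewrite F0// => Dx; apply: xD; rewrite inE.
Qed.

(** A point outside [D] lies in the open complement of the closed support, so [f] vanishes on a
    neighbourhood of it. *)
Lemma C10_outside (D : set 'rV[R]_n) f x : C10 D f -> ~ D x ->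
  f x = 0 /\ forall i, partial i f x = 0.
Proof.
move=> [_ [_ fD]] Dx.
have nx : nbhs x (~` closure [set y | f y != 0]).
  apply: open_nbhs_nbhs; split; first exact/closed_openC/closed_closure.
  by move=> /fD.
have nf : \near x, f x = 0.
  apply: filterS nx => y yf; apply/eqP; apply: contrapT => /negP fy.
  by apply: yf; exact: subset_closure.
split; first exact: nbhs_singleton nf.
by move=> i; rewrite -(partial_cst 0 i x); exact: near_eq_derive.
Qed.

(** Adding the divergence of $f^2\sum_jh_jX_j$, of integral zero, to $|Xf|^2-Vf^2$ completes the
    square: the sum is $\sum_j(X_jf+fh_j)^2+f^2(\mathrm{div}(h.X)-|h|^2-V)$. *)
Lemma barta_inequality (V : 'rV[R]_n -> R) (D : set 'rV[R]_n) (M lam : R)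
    (h : 'I_m -> 'rV[R]_n -> R) f :
  0 <= M -> (forall x, D x -> `|x| <= M) -> continuous V ->
  (forall j, smooth (h j)) ->
  (forall x, D x -> lam <= hdiv X h x - \sum_j h j x ^+ 2 - V x) -> C10 D f ->
  lam * integral_on D (fun x => f x ^+ 2) <=
  integral_on D (fun x => Xnorm2 X f x - V x * f x ^+ 2).
Proof.
move=> M0 DM cV sh hlam fD.
have Cf : Ck 1 f := fD.1.
have out x : ~ D x -> f x = 0 by move=> /(C10_outside fD)[].
have Mout x : M < `|x| -> ~ D x by move=> Mx /DM; rewrite leNgt Mx.
pose A x := Xnorm2 X f x - V x * f x ^+ 2.
pose B x := f x ^+ 2.
pose W x := \sum_j h j x *: X j x.
pose C := divergence (fun y => f y ^+ 2 *: W y).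
have A0 x : ~ D x -> A x = 0.
  move=> /(C10_outside fD)[fx pf]; rewrite /A fx expr0n mulr0 subr0.
  rewrite /Xnorm2 big1// => j _; rewrite /Xop big1 ?expr0n// => i _.
  by rewrite pf mulr0.
have sW : smooth_vfield W.
  move=> i; rewrite (_ : (fun x => W x 0 i) = fun x => \sum_j h j x * X j x 0 i).
    by apply: smooth_sum => j; apply: smoothM => //; exact: sX.
  by apply/funext => x; rewrite /W summxE; apply: eq_bigr => j _; rewrite mxE.
have Cf2W i : Ck 1 (fun x => (f x ^+ 2 *: W x) 0 i).
  under eq_fun do rewrite mxE.
  by apply: CkM; [exact: CkX|exact: sW].
have CE x : C x = f x ^+ 2 * hdiv X h x + 2 * f x * \sum_j h j x * Xop X j f x.
  have df : differentiable f x by case: Cf.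
  rewrite /C divergenceZ; last 2 first.
  - by under eq_fun do rewrite expr2; exact: differentiableM.
  - by move=> i; exact/smooth_differentiable/sW.
  rewrite /W divergence_sum; last first.
    by move=> j i; exact/smooth_differentiable/smooth_vfieldZ.
  congr (_ + _); rewrite /dirderiv.
  under eq_bigr => i _.
    rewrite (_ : partial i (fun y => f y ^+ 2) x = 2 * f x * partial i f x); last first.
      by under eq_fun do rewrite expr2; rewrite partialM//; ring.
    rewrite summxE mulr_suml; over.
  rewrite exchange_big mulr_sumr /=; apply: eq_bigr => j _.
  rewrite /Xop !mulr_sumr; apply: eq_bigr => i _; rewrite mxE.
  by ring.
have c0 g : Ck 1 g -> continuous g by move/Ck_pred.
have sA : supp_within M A.
  split=> [|x /Mout/A0//].
  suff : Ck 0 A by [].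
  apply: CkD.
    apply: Ck_sum => j; apply: CkX; apply: Ck_sum => i; apply: CkM.
      exact: (sX j i 0).
    by case: Cf => _; apply.
  by apply: CkN; apply: CkM => //; apply: CkX; exact: Ck_pred.
have sB : supp_within M B.
  split=> [|x /Mout/out fx]; last by rewrite /B fx expr0n.
  by suff : Ck 0 B by []; apply: CkX; exact: Ck_pred.
have sC : supp_within M C.
  split; last by move=> x /Mout/out fx; rewrite CE fx expr0n mul0r mulr0 mul0r addr0.
  suff : Ck 0 C by [].
  by apply: Ck_sum => i; case: (Cf2W i) => _; apply.
have iC : iint C = 0.
  apply: (iint_divergence M0) => // i; split; first exact: c0.
  by move=> x /Mout/out fx; rewrite mxE fx expr0n mul0r.
have -> : integral_on D (fun x => Xnorm2 X f x - V x * f x ^+ 2) = iint A.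
  exact: integral_on_supp.
have -> : integral_on D (fun x => f x ^+ 2) = iint B.
  by apply: integral_on_supp => x /out fx; rewrite fx expr0n.
have sCA : supp_within M (fun x => 1 * C x + A x).
  by apply: supp_withinD => //; apply: supp_withinMl => // x; exact: cst_continuous.
(* Since [C] has integral zero, nonnegativity of this integral is the claim; it is obtained
   pointwise. *)
have : 0 <= iint (fun x => - lam * B x + (1 * C x + A x)); last first.
  by rewrite !(iint_lincomb _ M0)// iC; lra.
apply: iint_ge0 => x; rewrite /A /B CE.
have sq : 0 <= \sum_j (Xop X j f x + f x * h j x) ^+ 2.
  by apply: sumr_ge0 => j _; exact: sqr_ge0.
have sqE : \sum_j (Xop X j f x + f x * h j x) ^+ 2 =
    Xnorm2 X f x + 2 * f x * (\sum_j h j x * Xop X j f x) +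
    f x ^+ 2 * \sum_j h j x ^+ 2.
  rewrite /Xnorm2 !mulr_sumr -!big_split /=; apply: eq_bigr => j _; ring.
have [Dx|/out fx] := pselect (D x); last first.
  by move: sq; rewrite sqE fx expr0n /=; lra.
have := ler_wpM2l (sqr_ge0 (f x)) (hlam x Dx).
by move: sq; rewrite sqE; lra.
Qed.

End integral_inequality.

(** * Choice of constants and positivity of the infimum *)

Lemma continuous_bound_on_ball (R : realType) n (f : 'rV[R]_n -> R) (M : R) :
  continuous f -> exists2 b, 0 <= b & forall x, `|x| <= M -> f x <= b.
Proof.
move=> cf; have [M0|M0] := ltP M 0.
  by exists 0 => // x xM; have := normr_ge0 x; rewrite leNgt (le_lt_trans xM).
have [|c _ fc] := EVT_max_rV (A := [set x : 'rV[R]_n | `|x| <= M]) _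
  (@compact_normr_le R n M) (continuous_subspaceT cf).
  by exists 0; rewrite /= normr0.
(* The maximum with 0 makes the bound plus 1 usable as a positive denominator. *)
exists (Num.max 0 (f c)); first by rewrite le_max lexx.
by move=> x xM; rewrite le_max fc ?orbT// inE.
Qed.

Theorem theorem1p2 (R : realType) (n m : nat) (X : 'I_m -> vfield R n)
  (V : 'rV[R]_n -> R) :
  (0 < n)%N ->
  hormander X ->
  smooth V ->
  (exists u : 'rV[R]_n -> R,
      smooth u /\ (forall x, 0 < u x) /\ (forall x, 0 <= Hlap X u x - V x * u x)) ->
  forall D : set 'rV[R]_n, regular_domain X D -> (0 < lambda1 X V D)%E.
Proof.
move=> n0 HX sV [u [su [u0 Hu]]] D [[_ [_ [_ [M1 [_ bD]]]]] _].
have sX := HX.1.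
(* Boundedness of [D] provides a norm bound by each number strictly above [M1]; this one is also
   nonnegative. *)
pose M := `|M1| + 1.
have M0 : 0 <= M by rewrite addr_ge0.
have DM x : D x -> `|x| <= M.
  by apply: (bD M); rewrite /M (le_lt_trans (ler_norm _))// ltrDl.
have [k [sk hk]] := hormander_hdiv_eq1 sX n0 HX.
(* The loss $\varepsilon^2|k|^2u^{-4}$ is the gain $\varepsilon u^{-2}$ multiplied by $\varepsilon
   s$. *)
pose s x := (u x)^-1 ^+ 2 * \sum_j k j x ^+ 2.
have uN0 x : u x != 0 by rewrite gt_eqF.
have cs : continuous s.
  suff : Ck 0 s by [].
  apply: CkM; first by apply: CkX; apply: CkV => //; exact: su.
  by apply: Ck_sum => j; apply: CkX; exact: sk.
have [b b0 sb] := continuous_bound_on_ball M cs.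
have cu2 : continuous (fun x => u x ^+ 2).
  by suff : Ck 0 (fun x => u x ^+ 2) by []; apply: CkX; exact: su.
have [c c0 uc] := continuous_bound_on_ball M cu2.
(* With $s\le b$ on the ball this gives $\varepsilon s\le 1/2$, so at least half of the gain
   survives. *)
pose eps := (2 * (b + 1))^-1.
(* Half of the gain, with $u^{-2}$ bounded below by $1/(c+1)$ on the ball. *)
pose lam := eps / (2 * (c + 1)).
have eps0 : 0 < eps by rewrite invr_gt0 mulr_gt0// ltr_wpDl.
have lam0 : 0 < lam by rewrite divr_gt0// mulr_gt0// ltr_wpDl.
pose h := barta_field X u k eps.
have hlam x : D x -> lam <= hdiv X h x - \sum_j h j x ^+ 2 - V x.
  move=> /DM xM; rewrite (hdiv_barta_field sX eps su u0 sk (hk x)).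
  have w0 : 0 < (u x)^-1 by rewrite invr_gt0.
  have Vle : V x <= Hlap X u x / u x.
    by rewrite ler_pdivlMr// -subr_ge0.
  have half : eps * s x <= 2^-1.
    rewrite /eps invfM -mulrA ler_piMr// mulrC ler_pdivrMr ?ltr_wpDl// mul1r.
    by rewrite (le_trans (sb x xM))// lerDl.
  have w2 : (c + 1)^-1 <= (u x)^-1 ^+ 2.
    rewrite exprVn lef_pV2 ?posrE ?exprn_gt0 ?ltr_wpDl//.
    by rewrite (le_trans (uc x xM))// lerDl.
  have -> : eps ^+ 2 * (u x)^-1 ^+ 4 * \sum_j k j x ^+ 2 =
      eps * (u x)^-1 ^+ 2 * (eps * s x) by rewrite /s; ring.
  have e1 : eps * (u x)^-1 ^+ 2 * (eps * s x) <= eps * (u x)^-1 ^+ 2 * 2^-1.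
    by rewrite ler_wpM2l// mulr_ge0 ?exprn_ge0// ltW.
  have e2 : eps * (c + 1)^-1 <= eps * (u x)^-1 ^+ 2 by rewrite ler_wpM2l// ltW.
  rewrite /lam invfM (mulrC 2^-1) mulrA; lra.
apply: (@lt_le_trans _ _ lam%:E); first by rewrite lte_fin.
(* Every admissible value is at least [lam], by the normalisation $\int_D f^2=1$; hence so is the
   infimum. *)
apply: le_ereal_inf_tmp => _ [f [fD f1] <-]; rewrite lee_fin -[lam]mulr1 -f1.
apply: (@barta_inequality _ _ _ X sX V D M lam h f) => //; first exact: (sV 0%N).
exact: smooth_barta_field.
Qed.
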